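(* Let $\mathcal{A}$ be a Hopf algebra with invertible antipode over a field and suppose the left coideal subalgebra $\mathcal{N}\subset\mathcal{A}$ is semisimple. Then $\mathcal{N}=\mathcal{N}_P$ for some right group-like projection $P\in\mathcal{A}$, and $\mathcal{N}_P=\mathcal{V}_P$.
   Context: $(\mathcal{A},\Delta,S,\varepsilon)$ is a Hopf algebra over an arbitrary field with invertible antipode $S$ and unit $1$. A left coideal subalgebra is a unital subalgebra $\mathcal{N}\subset\mathcal{A}$ with $\Delta(\mathcal{N})\subset\mathcal{A}\otimes\mathcal{N}$. A projection is an idempotent. A right group-like projection is a non-zero projection $P\in\mathcal{A}$ with $\Delta(P)(1\otimes P)=P\otimes P=(1\otimes P)\Delta(P)$. Define $\mathcal{N}_P=\{x\in\mathcal{A}:\Delta(x)(1\otimes P)=(1\otimes P)\Delta(x)=x\otimes P\}$ and $\mathcal{V}_P=\{(\mu\otimes\mathrm{id})(\Delta(P)):\mu\in\mathcal{A}^*\}$. *)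

(* Defs.v *)
From HB Require Import structures.
From mathcomp Require Import all_boot all_order all_algebra.
From mathcomp Require Import generic_quotient boolp classical_sets.

Set Implicit Arguments.
Unset Strict Implicit.
Unset Printing Implicit Defensive.

Import GRing.Theory.
Local Open Scope ring_scope.
Local Open Scope quotient_scope.
Local Open Scope classical_set_scope.

Declare Scope tens_scope.
Delimit Scope tens_scope with T.
Local Open Scope tens_scope.

(** [[:: (v1, w1); ...; (vn, wn)]] stands for [v1 (x) w1 + ... + vn (x) wn];
    [tens V W] is the quotient of such formal sums by the congruence generated
    by the bilinearity relations. *)

Section Tensor.
Variables (k : fieldType) (V W : lmodType k).

Inductive tens_rel : seq (V * W) -> seq (V * W) -> Prop :=
| TensRefl s : tens_rel s s
| TensSym s t : tens_rel s t -> tens_rel t s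
| TensTrans s t u : tens_rel s t -> tens_rel t u -> tens_rel s u
| TensCat s s' t t' :
    tens_rel s s' -> tens_rel t t' -> tens_rel (s ++ t) (s' ++ t')
| TensCatC s t : tens_rel (s ++ t) (t ++ s)
| TensZero w : tens_rel [:: (0, w)] [::]
| TensDl v v' w : tens_rel [:: (v + v', w)] [:: (v, w); (v', w)]
| TensDr v w w' : tens_rel [:: (v, w + w')] [:: (v, w); (v, w')]
| TensZ a v w : tens_rel [:: (a *: v, w)] [:: (v, a *: w)].

Definition tens_relb (s t : seq (V * W)) : bool := `[< tens_rel s t >].

Lemma tens_relb_refl : reflexive tens_relb.
Proof. by move=> s; apply/asboolP; exact: TensRefl. Qed.

Lemma tens_relb_sym : symmetric tens_relb.
Proof. by move=> s t; apply/asboolP/asboolP => /TensSym. Qed.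

Lemma tens_relb_trans : transitive tens_relb.
Proof.
by move=> s t u /asboolP ts /asboolP su; apply/asboolP; exact: TensTrans su.
Qed.

Canonical tens_equiv :=
  EquivRel tens_relb tens_relb_refl tens_relb_sym tens_relb_trans.

Definition tens := {eq_quot tens_equiv}.

HB.instance Definition _ := Choice.on tens.
HB.instance Definition _ := EqQuotient.on tens.

Lemma tens_piP s t : tens_rel s t <-> \pi_tens s = \pi_tens t.
Proof.
split=> [st|/eqmodP /asboolP //].
by apply/eqmodP/asboolP.
Qed.

Lemma tensW (P : tens -> Prop) : (forall s, P (\pi_tens s)) -> forall x, P x.
Proof. by move=> Ppi x; rewrite -[x]reprK; exact: Ppi. Qed.

Definition pure (v : V) (w : W) : tens := \pi_tens [:: (v, w)].

Let add (x y : tens) : tens := \pi_tens (repr x ++ repr y).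
Let opp (x : tens) : tens := \pi_tens [seq (- p.1, p.2) | p <- repr x].
Let scale (a : k) (x : tens) : tens :=
  \pi_tens [seq (a *: p.1, p.2) | p <- repr x].

Let reprR s : tens_rel (repr (\pi_tens s)) s.
Proof. by apply/tens_piP; rewrite reprK. Qed.

Let add_pi s t : add (\pi_tens s) (\pi_tens t) = \pi_tens (s ++ t).
Proof. by apply/tens_piP/TensCat; exact: reprR. Qed.

Let scale_rel a s t : tens_rel s t ->
  tens_rel [seq (a *: p.1, p.2) | p <- s] [seq (a *: p.1, p.2) | p <- t].
Proof.
elim=> {s t} /=.
- by move=> s; exact: TensRefl.
- by move=> s t _; exact: TensSym.
- by move=> s t u _ h1 _ h2; exact: TensTrans h2.
- by move=> s s' t t' _ h1 _ h2; rewrite !map_cat; exact: TensCat.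
- by move=> s t; rewrite !map_cat; exact: TensCatC.
- by move=> w; rewrite scaler0; exact: TensZero.
- by move=> v v' w; rewrite scalerDr; exact: TensDl.
- by move=> v w w'; exact: TensDr.
- by move=> b v w; rewrite scalerA mulrC -scalerA; exact: TensZ.
Qed.

Let scale_pi a s :
  scale a (\pi_tens s) = \pi_tens [seq (a *: p.1, p.2) | p <- s].
Proof. by apply/tens_piP/scale_rel; exact: reprR. Qed.

Let oppE x : opp x = scale (-1) x.
Proof. by congr \pi_tens; apply: eq_map => p /=; rewrite scaleN1r. Qed.

Let addA : associative add.
Proof.
move=> x y z; elim/tensW: x => s; elim/tensW: y => t; elim/tensW: z => u.
by rewrite !add_pi catA.
Qed.

Let addC : commutative add.
Proof.
move=> x y; elim/tensW: x => s; elim/tensW: y => t; rewrite !add_pi.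
by apply/tens_piP; exact: TensCatC.
Qed.

Let add0 : left_id (\pi_tens [::]) add.
Proof. by move=> x; elim/tensW: x => s; rewrite add_pi. Qed.

Let scaleDl x a b : scale (a + b) x = add (scale a x) (scale b x).
Proof.
elim/tensW: x => s; rewrite !scale_pi add_pi; apply/tens_piP.
elim: s => [|[v w] s IH] /=; first exact: TensRefl.
rewrite scalerDl.
have H := TensCat (TensDl (a *: v) (b *: v) w) IH.
apply: (TensTrans H) => /=.
have swap y s1 s2 : tens_rel (y :: s1 ++ s2) (s1 ++ y :: s2).
  rewrite -cat1s -(cat1s y s2) !catA.
  by apply: TensCat; [exact: TensCatC | exact: TensRefl].
exact: (TensCat (TensRefl [:: (a *: v, w)]) (swap (b *: v, w) _ _)).
Qed.

Let scale0 x : scale 0 x = \pi_tens [::].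
Proof.
elim/tensW: x => s; rewrite scale_pi; apply/tens_piP.
elim: s => [|[v w] s IH] /=; first exact: TensRefl.
by rewrite scale0r; exact: (TensCat (TensZero w) IH).
Qed.

Let scale1 : left_id 1 scale.
Proof.
move=> x; elim/tensW: x => s; rewrite scale_pi; congr \pi_tens.
by rewrite -[RHS]map_id; apply: eq_map => -[v w] /=; rewrite scale1r.
Qed.

Let scaleA a b x : scale a (scale b x) = scale (a * b) x.
Proof.
elim/tensW: x => s; rewrite !scale_pi -map_comp; congr \pi_tens.
by apply: eq_map => p /=; rewrite scalerA.
Qed.

Let scaleDr : right_distributive scale add.
Proof.
move=> a x y; elim/tensW: x => s; elim/tensW: y => t.
by rewrite !(scale_pi, add_pi) map_cat.
Qed.

Let addN : left_inverse (\pi_tens [::]) opp add.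
Proof.
by move=> x; rewrite oppE -{2}[x]scale1 -scaleDl addNr scale0.
Qed.

HB.instance Definition _ := GRing.isZmodule.Build tens addA addC add0 addN.

HB.instance Definition _ := GRing.Zmodule_isLmodule.Build k tens
  scaleA scale1 scaleDr scaleDl.

Lemma pi_tens_sum s : \pi_tens s = \sum_(p <- s) pure p.1 p.2.
Proof.
elim: s => [|[v w] s IH]; first by rewrite big_nil.
by rewrite big_cons -IH -[LHS](add_pi [:: (v, w)] s).
Qed.

Lemma tens_sumE x : x = \sum_(p <- repr x) pure p.1 p.2.
Proof. by rewrite -pi_tens_sum reprK. Qed.

Lemma pureDl v v' w : pure (v + v') w = pure v w + pure v' w.
Proof. by rewrite [RHS]add_pi; apply/tens_piP; exact: TensDl. Qed.

Lemma pureDr v w w' : pure v (w + w') = pure v w + pure v w'.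
Proof. by rewrite [RHS]add_pi; apply/tens_piP; exact: TensDr. Qed.

Lemma pureZl a v w : pure (a *: v) w = a *: pure v w.
Proof. by rewrite [RHS]scale_pi. Qed.

Lemma pureZr a v w : pure v (a *: w) = a *: pure v w.
Proof. by rewrite -pureZl; apply/tens_piP/TensSym; exact: TensZ. Qed.

End Tensor.

Arguments pure {k V W} v w.
Notation "V ⊗ W" := (tens V%type W%type) (at level 40, left associativity) : type_scope.
Notation "v ⊗ w" := (pure v w) (at level 40, left associativity) : tens_scope.

Section TensorLift.
Variables (k : fieldType) (V W U : lmodType k).

(** [tlift f] is the linear map sending [v ⊗ w] to [f v w]; it is only
    meaningful for a bilinear [f] (see [tlift_pure]). *)
Definition tlift (f : V -> W -> U) (x : V ⊗ W) : U :=
  \sum_(p <- repr x) f p.1 p.2.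

Definition bilinear_map (f : V -> W -> U) : Prop :=
  (forall w, linear (f^~ w)) /\ (forall v, linear (f v)).

Variable f : V -> W -> U.
Hypothesis f_bilin : bilinear_map f.

Lemma tlift_pi s : tlift f (\pi_(V ⊗ W) s) = \sum_(p <- s) f p.1 p.2.
Proof.
have [fl fr] := f_bilin.
have fDl v v' w : f (v + v') w = f v w + f v' w.
  by have := fl w 1 v v'; rewrite /= !scale1r.
have fDr v w w' : f v (w + w') = f v w + f v w'.
  by have := fr v 1 w w'; rewrite !scale1r.
have f0l w : f 0 w = 0.
  by apply: (addrI (f 0 w)); rewrite -fDl !addr0.
have f0r v : f v 0 = 0.
  by apply: (addrI (f v 0)); rewrite -fDr !addr0.
have inv t u : tens_rel t u ->
  \sum_(p <- t) f p.1 p.2 = \sum_(p <- u) f p.1 p.2; last first.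
  by apply: inv; apply/tens_piP; rewrite reprK.
elim=> {s t u} //=.
- by move=> s t u _ -> _ ->.
- by move=> s s' t t' _ h1 _ h2; rewrite !big_cat h1 h2.
- by move=> s t; rewrite !big_cat /= addrC.
- by move=> w; rewrite big_seq1 big_nil.
- by move=> v v' w; rewrite big_seq1 big_cons big_seq1 /=.
- by move=> v w w'; rewrite big_seq1 big_cons big_seq1 /=.
- move=> a v w; rewrite !big_seq1 /=.
  have := fl w a v 0; have := fr v a w 0.
  by rewrite /= !(addr0, f0l, f0r) => -> ->.
Qed.

Lemma tlift_pure v w : tlift f (v ⊗ w) = f v w.
Proof. by rewrite tlift_pi big_seq1. Qed.

Lemma tlift_linear : linear (tlift f).
Proof.
have [fl _] := f_bilin.
have fZl a v w : f (a *: v) w = a *: f v w.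
  have f0l : f 0 w = 0.
    apply: (addrI (f 0 w)); have := fl w 1 0 0.
    by rewrite /= !scale1r !addr0 => <-.
  by have := fl w a v 0; rewrite /= !(addr0, f0l).
move=> a x y; rewrite {1}[x]tens_sumE {1}[y]tens_sumE scaler_sumr.
under eq_bigr do rewrite -pureZl.
rewrite -(big_map (fun p : V * W => (a *: p.1, p.2)) xpredT
  (fun p => p.1 ⊗ p.2)) -big_cat -pi_tens_sum tlift_pi big_cat big_map /=.
by rewrite scaler_sumr; congr (_ + _); apply: eq_bigr => p _; rewrite fZl.
Qed.

End TensorLift.

Lemma tens_ind (k : fieldType) (V W : lmodType k) (P : V ⊗ W -> Prop) :
  P 0 -> (forall x y, P x -> P y -> P (x + y)) ->
  (forall v w, P (v ⊗ w)) -> forall x, P x.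
Proof.
by move=> P0 PD Pp x; rewrite [x]tens_sumE; elim/big_ind: _.
Qed.

Section TensorRing.
Variables (k : fieldType) (A B : algType k).

Let mulf (a : A) (b : B) (a' : A) (b' : B) : A ⊗ B := (a * a') ⊗ (b * b').

Let mulf_bilin a b : bilinear_map (mulf a b).
Proof.
split=> [w c v v'|v c w w'] /=; rewrite /mulf mulrDr -scalerAr.
  by rewrite pureDl pureZl.
by rewrite pureDr pureZr.
Qed.

Let mul (x y : A ⊗ B) : A ⊗ B := tlift (fun a b => tlift (mulf a b) y) x.

Let mul_bilin y : bilinear_map (fun a b => tlift (mulf a b) y).
Proof.
split=> [b c a a'|a c b b'] /=; rewrite /tlift scaler_sumr -big_split /=;
  apply: eq_bigr => p _; rewrite /mulf mulrDl -scalerAl.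
  by rewrite pureDl pureZl.
by rewrite pureDr pureZr.
Qed.

Let mul_pure a b a' b' : mul (a ⊗ b) (a' ⊗ b') = (a * a') ⊗ (b * b').
Proof.
by rewrite /mul (tlift_pure (mul_bilin _)) (tlift_pure (mulf_bilin _ _)).
Qed.

Let mulDl : left_distributive mul +%R.
Proof.
move=> x y z; rewrite /mul.
by have := tlift_linear (mul_bilin z) 1 x y; rewrite !scale1r.
Qed.

Let mulDr : right_distributive mul +%R.
Proof.
move=> x y z; rewrite /mul /tlift -big_split /=; apply: eq_bigr => p _.
by have := tlift_linear (mulf_bilin p.1 p.2) 1 y z; rewrite !scale1r.
Qed.

Let mul0 x : mul 0 x = 0.
Proof. by apply: (addrI (mul 0 x)); rewrite -mulDl !addr0. Qed.

Let mulx0 x : mul x 0 = 0.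
Proof. by apply: (addrI (mul x 0)); rewrite -mulDr !addr0. Qed.

Let mulA : associative mul.
Proof.
move=> x y z; elim/tens_ind: x => [|x x' hx hx'|a b].
- by rewrite !mul0.
- by rewrite !mulDl hx hx'.
elim/tens_ind: y => [|y y' hy hy'|a' b'].
- by rewrite !(mul0, mulx0).
- by rewrite mulDl !mulDr mulDl hy hy'.
elim/tens_ind: z => [|z z' hz hz'|a'' b''].
- by rewrite !mulx0.
- by rewrite !mulDr hz hz'.
by rewrite !mul_pure !mulrA.
Qed.

Let mul1 : left_id (1 ⊗ 1) mul.
Proof.
move=> z; elim/tens_ind: z => [|x y hx hy|a b]; first exact: mulx0.
  by rewrite mulDr hx hy.
by rewrite mul_pure !mul1r.
Qed.

Let mulx1 : right_id (1 ⊗ 1) mul.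
Proof.
move=> z; elim/tens_ind: z => [|x y hx hy|a b]; first exact: mul0.
  by rewrite mulDl hx hy.
by rewrite mul_pure !mulr1.
Qed.

(* An [algType] instance would require [1 != 0], which is not needed here. *)
HB.instance Definition _ := GRing.Zmodule_isPzRing.Build (tens A B)
  mulA mul1 mulx1 mulDl mulDr.

Lemma tens_mulE (a a' : A) (b b' : B) :
  (a ⊗ b) * (a' ⊗ b') = (a * a') ⊗ (b * b').
Proof. exact: mul_pure. Qed.

Lemma tens_oneE : 1 = 1 ⊗ 1 :> A ⊗ B.
Proof. by []. Qed.

End TensorRing.

Section TensorMaps.
Variable k : fieldType.

Definition tmap (V W V' W' : lmodType k) (f : V -> V') (g : W -> W') :
    V ⊗ W -> V' ⊗ W' :=
  tlift (fun v w => f v ⊗ g w).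

Definition tassoc (U V W : lmodType k) : (U ⊗ V) ⊗ W -> U ⊗ (V ⊗ W) :=
  tlift (fun x w => tlift (fun u v => u ⊗ (v ⊗ w)) x).

(** [slice mu] is [mu ⊗ id] and [slicer nu] is [id ⊗ nu], with [k ⊗ W] and
    [V ⊗ k] identified with [W] and [V]. *)
Definition slice (V W : lmodType k) (mu : V -> k) : V ⊗ W -> W :=
  tlift (fun v w => mu v *: w).

Definition slicer (V W : lmodType k) (nu : W -> k) : V ⊗ W -> V :=
  tlift (fun v w => nu w *: v).

End TensorMaps.

HB.mixin Record isHopfAlgebra (k : fieldType) A of GRing.Algebra k A := {
  Delta : {lrmorphism A -> A ⊗ A};
  eps : {lrmorphism A -> k | *%R};
  antipode : {linear A -> A};
  DeltaA : forall x : A, tassoc (tmap Delta idfun (Delta x)) =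
                     tmap idfun Delta (Delta x);
  eps_Deltal : forall x : A, slice eps (Delta x) = x;
  eps_Deltar : forall x : A, slicer eps (Delta x) = x;
  antipodel : forall x : A,
    tlift (fun a b => antipode a * b) (Delta x) = (eps x)%:A;
  antipoder : forall x : A,
    tlift (fun a b => a * antipode b) (Delta x) = (eps x)%:A
}.

#[short(type="hopfAlgType")]
HB.structure Definition HopfAlgebra (k : fieldType) :=
  {A of GRing.Algebra k A & isHopfAlgebra k A}.

Section Semisimple.
Variables (R : pzRingType) (M : lmodType R).

Definition simple_submod (U : submodClosed M) : Prop :=
  (exists2 x, x \in U & x != 0) /\
  forall U' : submodClosed M, {subset U' <= U} ->
    (forall x, x \in U' -> x = 0) \/ {subset U <= U'}.

(** [M] is the sum of its simple submodules; no finiteness is assumed. *)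
Definition semisimple_module : Prop :=
  forall x : M, exists2 s : seq M, x = \sum_(y <- s) y &
    forall y, y \in s -> exists2 U : submodClosed M, simple_submod U & y \in U.

End Semisimple.

Definition semisimple_ring (R : pzRingType) : Prop := semisimple_module R^o.

Section SubalgType.
Variables (k : fieldType) (A : algType k) (N : subalgClosed A).

Definition subalg_type : Type := {x : A | x \in N}.

HB.instance Definition _ := SubChoice.on subalg_type.
HB.instance Definition _ := [SubChoice_isSubAlgebra of subalg_type by <:].

End SubalgType.

Section GroupLike.
Variables (k : fieldType) (A : hopfAlgType k).

Definition left_coideal (N : {pred A}) : Prop :=
  forall x, x \in N -> exists2 s : seq (A * A),
    Delta x = \sum_(p <- s) p.1 ⊗ p.2 & forall p, p \in s -> p.2 \in N.

Definition right_grouplike_projection (P : A) : Prop :=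
  [/\ P != 0, P * P = P,
      Delta P * (1 ⊗ P) = P ⊗ P & P ⊗ P = (1 ⊗ P) * Delta P].

Definition NP (P : A) : set A :=
  [set x | Delta x * (1 ⊗ P) = (1 ⊗ P) * Delta x /\
           (1 ⊗ P) * Delta x = x ⊗ P].

Definition VP (P : A) : set A :=
  [set slice mu (Delta P) | mu in [set: {scalar A}]].

End GroupLike.

(* Main.v *)
From HB Require Import structures.
Require Import Defs.
From mathcomp Require Import all_boot all_order all_algebra.
From mathcomp Require Import boolp classical_sets.

(** The projection is the normalised two-sided integral of [N].

    The augmentation ideal of the semisimple ring [N] has an identity element
    [e] ([semisimple_ideal_identity]), so [P = 1 - e] lies in [N] and satisfies
    [x P = P x = eps(x) P] for [x] in [N] and [eps(P) = 1] ([integral_exists]).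
    Since the right legs of [Delta x] stay in [N], they are absorbed by [P]
    through [eps], and the counit axiom gives [Delta x (1 ⊗ P) = x ⊗ P], with
    the same value on the other side ([coideal_sub_NP]).  Hence [N] is contained
    in [N_P]; for [x = P] these are the equations of a right group-like
    projection.  The coideal property also gives that [V_P] is contained in [N].

    The remaining inclusion, of [N_P] in [V_P], follows from two facts.
    - [V_P] is stable under left multiplication by [N_P], because
      [(1 ⊗ x) Delta P = (S x ⊗ 1) Delta P] for [x] in [N_P] ([antipode_swap]):
      multiplying a slice of [Delta P] by [x] only changes the functional.
    - [1] is in [V_P].  As a left ideal of [N], [V_P] has a right identity [e] in
      itself ([semisimple_right_identity]).  All the left slices of [Delta P (1 ⊗ e)] and of [Delta P] agree,
      and slices separate tensors ([slices_separate]), so the two are equal;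
      applying [a ⊗ b |-> S(a) b] yields [eps(P) e = eps(P)], that is [e = 1]
      ([VP_right_identity]).

    That slices separate tensors needs enough linear functionals on a space of
    arbitrary dimension, which Zorn's lemma provides
    ([separating_functional]). *)

Set Implicit Arguments.
Unset Strict Implicit.
Unset Printing Implicit Defensive.

Import GRing.Theory.
Local Open Scope ring_scope.
Local Open Scope classical_set_scope.
Local Open Scope tens_scope.

(** * Submodules as classical sets *)

(** Sets rather than boolean predicates: the submodules of interest are cut out
    by existential statements. *)
Definition submodule (R : pzRingType) (M : lmodType R) (W : set M) : Prop :=
  W 0 /\ forall a x y, W x -> W y -> W (a *: x + y).

Section Submodule.
Variables (R : pzRingType) (M : lmodType R).
Implicit Types (U W : set M) (x y : M).

Lemma submoduleD W x y : submodule W -> W x -> W y -> W (x + y).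
Proof. by move=> [_ WD] Wx Wy; have := WD 1 x y Wx Wy; rewrite scale1r. Qed.

Lemma submoduleZ W a x : submodule W -> W x -> W (a *: x).
Proof. by move=> [W0 WD] Wx; have := WD a x 0 Wx W0; rewrite addr0. Qed.

Lemma submoduleB W x y : submodule W -> W x -> W y -> W (x - y).
Proof.
move=> sW Wx Wy; rewrite -scaleN1r.
by apply: submoduleD => //; apply: submoduleZ.
Qed.

Lemma submodule_in (U : submodClosed M) : submodule [set` U].
Proof.
split=> [|a x y /= Ux Uy]; first exact: rpred0.
by rewrite /= rpredD ?rpredZ.
Qed.

Lemma submoduleP W : submodule W ->
  exists U : submodClosed M, forall x, (x \in U) <-> W x.
Proof.
move=> [W0 WD]; pose S : {pred M} := fun x => `[< W x >].
have SP : subsemimod_closed S.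
  have WZ a x : W x -> W (a *: x).
    by move=> Wx; rewrite -[_ *: _]addr0; exact: WD.
  split; first split.
  - exact/asboolP.
  - move=> x y /asboolP Wx /asboolP Wy; apply/asboolP.
    by rewrite -[x]scale1r; exact: WD.
  - by move=> a x /asboolP Wx; apply/asboolP; exact: WZ.
pose mS := GRing.isSubmodClosed.Build R M S SP.
pose U : submodClosed M := HB.pack S mS.
by exists U => x; split=> [/asboolP|Wx] //; apply/asboolP.
Qed.

Lemma submodule_add U W : submodule U -> submodule W ->
  submodule [set x | exists2 u, U u & exists2 w, W w & x = u + w].
Proof.
move=> sU sW; split.
  by exists 0; [case: sU | exists 0; [case: sW | rewrite addr0]].
move=> a _ _ [u Uu [w Ww ->]] [u' Uu' [w' Ww' ->]].
exists (a *: u + u'); first by case: sU => _; apply.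
exists (a *: w + w'); first by case: sW => _; apply.
by rewrite scalerDr addrACA.
Qed.

End Submodule.

(** * Linear functionals on spaces of arbitrary dimension *)

Section Functionals.
Variables (k : fieldType) (V : lmodType k).

Lemma scalar_functional (f : V -> k) :
  scalar f -> exists mu : {scalar V}, mu =1 f.
Proof.
move=> f_lin; pose fM := GRing.isLinear.Build k V k *%R f f_lin.
by exists (HB.pack f fM : {scalar V}).
Qed.

(** A subspace [B] maximal among those that contain [W] and avoid [v] is a
    hyperplane supplementary to the line of [v]; the functional is the
    coordinate along [v]. *)
Lemma separating_functional (W : set V) v : submodule W -> ~ W v ->
  exists mu : {scalar V}, (forall w, W w -> mu w = 0) /\ mu v = 1.
Proof.
move=> sW Wv.
(* Zorn is applied to the part added to [W], so that the empty chain, whose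
   union is empty, is not an exception. *)
pose P (X : set V) := submodule (W `|` X) /\ ~ (W `|` X) v.
have [F FP Ftot|A [[sA Av] Amax]] := @Zorn_bigcup V P.
  split; last first.
    by case=> [//|[X FX Xv]]; case: (FP X FX) => _; apply; right.
  split=> [|a x y Hx Hy]; first by left; case: sW.
  have up X : F X -> (W `|` X) `<=` (W `|` \bigcup_(X in F) X).
    by move=> FX z [Wz|Xz]; [left | right; exists X].
  case: Hx => [Wx|[X FX Xx]]; case: Hy => [Wy|[Y FY Yy]].
  - by left; case: sW => _; apply.
  - by apply: (up Y FY); case: (FP Y FY) => -[_ +] _; apply; [left|right].
  - by apply: (up X FX); case: (FP X FX) => -[_ +] _; apply; [right|left].
  - have [XY|YX] := Ftot X Y FX FY.
      apply: (up Y FY); case: (FP Y FY) => -[_ +] _.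
      by apply; right => //; exact: XY.
    apply: (up X FX); case: (FP X FX) => -[_ +] _.
    by apply; right => //; exact: YX.
pose B := W `|` A.
(* If [x] is not in [B], then [B + k x] contains [v] by maximality. *)
have decomp x : exists c, B (x - c *: v).
  have [Bx|nBx] := pselect (B x); first by exists 0; rewrite scale0r subr0.
  pose line := [set z | exists c, z = c *: x].
  have sline : submodule line.
    split=> [|a _ _ [c ->] [d ->]]; first by exists 0; rewrite scale0r.
    by exists (a * c + d); rewrite scalerDl scalerA.
  pose C := [set z | exists2 u, B u & exists2 w, line w & z = u + w].
  have sC : submodule C by exact: submodule_add.
  have BC : B `<=` C.
    move=> b Bb; exists b => //; exists 0; last by rewrite addr0.
    by exists 0; rewrite scale0r.
  have Cx : C x.
    exists 0; first by case: sA.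
    by exists x; [exists 1; rewrite scale1r | rewrite add0r].
  have WC : W `|` C = C.
    by apply/seteqP; split=> z; [case=> // Wz; apply: BC; left | right].
  have [Cv|nCv] := pselect (C v); last first.
    case: (Amax C); last by rewrite /P WC.
    split=> [z Az|CA]; first by apply: BC; right.
    by apply: nBx; right; exact: CA.
  have [b Bb [_ [c ->] vE]] := Cv.
  have c0 : c != 0 by apply/eqP => c0; apply: Av; rewrite vE c0 scale0r addr0.
  exists c^-1; rewrite vE scalerDr scalerA mulVf // scale1r opprD addrCA subrr.
  rewrite addr0 -scalerN; apply: submoduleZ => //.
  by rewrite -scaleN1r; apply: submoduleZ.
have uniq_coef x c d : B (x - c *: v) -> B (x - d *: v) -> c = d.
  move=> Bc Bd; apply/eqP; rewrite -subr_eq0; apply: contraT => cd.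
  case: Av; rewrite -[v]scale1r -(mulVf cd) -scalerA; apply: submoduleZ => //.
  have := submoduleB sA Bd Bc.
  by rewrite scalerBl opprB addrC subrKA.
pose f x := projT1 (cid (decomp x)).
have fP x : B (x - f x *: v) by rewrite /f; case: cid.
have f_lin : scalar f.
  move=> a x y; apply: (uniq_coef (a *: x + y)) => //=.
  have -> : a *: x + y - (a * f x + f y) *: v =
      a *: (x - f x *: v) + (y - f y *: v).
    by rewrite scalerDl -scalerA scalerBr addrACA opprD.
  by case: sA => _; apply; exact: fP.
have [mu muE] := scalar_functional f_lin.
exists mu; split=> [w Ww|]; rewrite muE; apply: (uniq_coef _ _ _ (fP _)).
  by rewrite scale0r subr0; left.
by rewrite scale1r subrr; case: sA.
Qed.

End Functionals.

(** * Slices of tensors *)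

Section TensorFacts.
Variables (k : fieldType).

Lemma linear_tens_eq (V W U : lmodType k) (F G : V ⊗ W -> U) :
  linear F -> linear G -> (forall v w, F (v ⊗ w) = G (v ⊗ w)) -> F =1 G.
Proof.
move=> lF lG FG t.
have F0 : F 0 = 0 by have := lF (-1) 0 0; rewrite scaler0 addr0 scaleN1r addNr.
have G0 : G 0 = 0 by have := lG (-1) 0 0; rewrite scaler0 addr0 scaleN1r addNr.
elim/tens_ind: t => [|x y Fx Fy|v w]; rewrite ?F0 ?G0 ?FG //.
by have := lF 1 x y; have := lG 1 x y; rewrite !scale1r Fx Fy => -> ->.
Qed.

Lemma tlift_sum (V W U : lmodType k) (f : V -> W -> U) (s : seq (V * W)) :
  bilinear_map f -> tlift f (\sum_(p <- s) p.1 ⊗ p.2) = \sum_(p <- s) f p.1 p.2.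
Proof. by move=> bf; rewrite -pi_tens_sum tlift_pi. Qed.

Lemma pure_suml (V W : lmodType k) (I : Type) (r : seq I) (F : I -> V) (w : W) :
  (\sum_(i <- r) F i) ⊗ w = \sum_(i <- r) (F i ⊗ w).
Proof.
have p0 : (0 : V) ⊗ w = 0 by rewrite -(scale0r (0 : V)) pureZl scale0r.
by apply: (big_morph (fun v => v ⊗ w)) => // v v'; exact: pureDl.
Qed.

Lemma slice_bilinear (V W : lmodType k) (mu : {scalar V}) :
  bilinear_map (fun v (w : W) => mu v *: w).
Proof.
split=> [w a v v'|v a w w'] /=.
  by rewrite linearP scalerDl scalerA.
by rewrite scalerDr !scalerA mulrC.
Qed.

Lemma slice_linear (V W : lmodType k) (mu : {scalar V}) :
  linear (@slice k V W mu).
Proof. exact/tlift_linear/slice_bilinear. Qed.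

Lemma slice_pure (V W : lmodType k) (mu : {scalar V}) (v : V) (w : W) :
  slice mu (v ⊗ w) = mu v *: w.
Proof. exact/tlift_pure/slice_bilinear. Qed.

Lemma slice_sum (V W : lmodType k) (mu : {scalar V}) (s : seq (V * W)) :
  slice mu (\sum_(p <- s) p.1 ⊗ p.2) = \sum_(p <- s) mu p.1 *: p.2.
Proof. exact/tlift_sum/slice_bilinear. Qed.

(** Induction on the number of terms.  Either [v 0] is in the span of the other
    [v i] and the first term can be distributed over the others, or a functional
    vanishing on this span and equal to 1 at [v 0] shows that [w 0] is zero. *)
Lemma slices_separate_sum (V W : lmodType k) n (v : 'I_n -> V) (w : 'I_n -> W) :
  (forall mu : {scalar V}, \sum_i mu (v i) *: w i = 0) ->
  \sum_i v i ⊗ w i = 0.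
Proof.
elim: n v w => [|n IH] v w sl0; first by rewrite big_ord0.
rewrite big_ord_recl; set v0 := v ord0; set w0 := w ord0.
pose span := [set x | exists c : 'I_n -> k, x = \sum_i c i *: v (lift ord0 i)].
have [[c v0E]|v0_indep] := pselect (span v0).
  have -> : v0 ⊗ w0 + \sum_i v (lift ord0 i) ⊗ w (lift ord0 i) =
      \sum_i v (lift ord0 i) ⊗ (w (lift ord0 i) + c i *: w0).
    rewrite v0E pure_suml -big_split; apply: eq_bigr => i _ /=.
    by rewrite pureDr pureZl pureZr addrC.
  apply: IH => mu; rewrite -[RHS](sl0 mu) big_ord_recl -/v0 -/w0 v0E.
  rewrite linear_sum scaler_suml -big_split; apply: eq_bigr => i _ /=.
  by rewrite linearZ scalerDr scalerA mulrC addrC.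
have span_sub : submodule span.
  split=> [|a _ _ [c ->] [d ->]].
    by exists (fun=> 0); rewrite big1 // => i _; rewrite scale0r.
  exists (fun i => a * c i + d i); rewrite scaler_sumr -big_split.
  by apply: eq_bigr => i _ /=; rewrite scalerDl scalerA.
have span_v i : span (v (lift ord0 i)).
  exists (fun j => (j == i)%:R); rewrite (bigD1 i) //= eqxx scale1r.
  by rewrite big1 ?addr0 // => j /negPf ->; rewrite scale0r.
have [mu [mu_span mu_v0]] := separating_functional span_sub v0_indep.
have w0_0 : w0 = 0.
  rewrite -[RHS](sl0 mu) big_ord_recl -/v0 -/w0 mu_v0 scale1r.
  by rewrite big1 ?addr0 // => i _; rewrite mu_span ?scale0r.
rewrite w0_0 -(scale0r (0 : W)) pureZr scale0r add0r; apply: IH => mu'.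
by rewrite -[RHS](sl0 mu') big_ord_recl -/w0 w0_0 scaler0 add0r.
Qed.

Lemma slices_separate (V W : lmodType k) (t : V ⊗ W) :
  (forall mu : {scalar V}, slice mu t = 0) -> t = 0.
Proof.
rewrite [t]tens_sumE => t0; rewrite big_tnth; apply: slices_separate_sum => mu.
by rewrite -[RHS](t0 mu) slice_sum [RHS]big_tnth.
Qed.

End TensorFacts.

(** * Left ideals of semisimple rings *)

Section SemisimpleRing.
Variable R : pzRingType.

(** Complements are built by adding simple submodules one at a time: a simple
    [S] either meets [U + C] in zero, and is then added to [C], or is contained
    in [U + C]. *)
Lemma finite_relative_complement (M : lmodType R) (U : set M) (s : seq M) :
  submodule U ->
  (forall y, y \in s ->
     exists2 S : submodClosed M, simple_submod S & y \in S) ->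
  exists C : set M, [/\ submodule C, forall x, U x -> C x -> x = 0 &
    forall y, y \in s -> exists2 u, U u & exists2 c, C c & y = u + c].
Proof.
move=> sU; elim: s => [_|y s IH simp].
  by exists [set 0]; split=> //; split=> // a _ _ -> ->; rewrite scaler0 addr0.
have [z zs|C [sC UC Cs]] := IH; first by apply: simp; rewrite inE zs orbT.
have [S [_ Smin] yS] := simp y (mem_head y s).
pose D := [set x | exists2 u, U u & exists2 c, C c & x = u + c].
have sD : submodule D by exact: submodule_add.
pose SD := [set x | x \in S /\ D x].
have sS := submodule_in S.
have sSD : submodule SD.
  split=> [|a x z [xS Dx] [zS Dz]]; split.
  - by case: sS.
  - by case: sD.
  - by case: sS => _; apply.
  - by case: sD => _; apply.
have [U' U'P] := submoduleP sSD.
have [SD0|SsubD] := Smin U' (fun x => fun xU' => proj1 (proj1 (U'P x) xU')).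
  exists [set x | exists2 c, C c & exists2 z, z \in S & x = c + z]; split.
  - exact: submodule_add.
  - move=> x Ux [c Cc [z zS xE]].
    have z0 : z = 0.
      apply: SD0; apply/U'P; split=> //; exists x => //; exists (- c).
        by rewrite -scaleN1r; apply: submoduleZ.
      by rewrite xE addrC addKr.
    by apply: UC => //; rewrite xE z0 addr0.
  - move=> x; rewrite inE => /predU1P[->|/Cs[u Uu [c Cc ->]]].
      exists 0; first by case: sU.
      exists y; last by rewrite add0r.
      by exists 0; [case: sC | exists y; rewrite ?add0r].
    exists u => //; exists c => //; exists c => //.
    by exists 0; [case: sS | rewrite addr0].
exists C; split=> // x; rewrite inE => /predU1P[->|/Cs//].
by have /U'P[] := SsubD y yS.
Qed.

(** If [R = U + C] is a direct sum and [1 = e + f] accordingly, then for [x] in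
    [U] the element [x f = x - x e] lies in both summands, so it is zero. *)
Lemma semisimple_right_identity (U : set R^o) :
  semisimple_ring R -> submodule U ->
  exists2 e : R, U e & forall x, U x -> x * e = x.
Proof.
move=> ssR sU; have [s sE simp] := ssR 1.
have [C [sC UC Cs]] := finite_relative_complement sU simp.
have [e Ue [f Cf ef]] : exists2 u, U u & exists2 c, C c & (1 : R^o) = u + c.
  rewrite sE; clear sE simp.
  elim: s Cs => [|y s IH] Cs.
    by exists 0; [case: sU | exists 0; [case: sC | rewrite big_nil addr0]].
  have [z zs|u Uu [c Cc E]] := IH; first by apply: Cs; rewrite inE zs orbT.
  have [u' Uu' [c' Cc' E']] := Cs y (mem_head y s).
  exists (u' + u); first exact: submoduleD.
  by exists (c' + c); [exact: submoduleD | rewrite big_cons E E' addrACA].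
exists e => // x Ux.
have xE : x = x * e + x * f by rewrite -mulrDr -[e + f]ef mulr1.
have xf0 : x * f = 0.
  apply: UC; last exact: (submoduleZ x sC Cf).
  have -> : x * f = x - x * e by rewrite {2}xE addrC addKr.
  by apply: submoduleB => //; exact: (submoduleZ x sU Ue).
by rewrite {2}xE xf0 addr0.
Qed.

(** A semisimple ring is semiprime: for the right identity [e] of [J] and
    [y = x - e x], one has [J y = 0], so [R y] squares to zero, and its own
    right identity forces [y = 0]. *)
Lemma semisimple_ideal_identity (J : set R^o) :
  semisimple_ring R -> submodule J -> (forall x r, J x -> J (x * r : R)) ->
  exists2 e : R, J e & forall x, J x -> x * e = x /\ e * x = x.
Proof.
move=> ssR sJ Jr; have [e Je eJ] := semisimple_right_identity ssR sJ.
exists e => // x Jx; split; first exact: eJ.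
pose y : R := x - e * x.
suff y0 : y = 0 by apply/eqP; rewrite eq_sym -subr_eq0 -/y y0.
pose Ry : set R^o := [set z | exists r : R, z = r * y].
have sRy : submodule Ry.
  split=> [|a _ _ [r ->] [r' ->]]; first by exists 0; rewrite mul0r.
  by exists (a * r + r'); rewrite mulrDl -mulrA.
have [f [r ->] fRy] := semisimple_right_identity ssR sRy.
have := fRy y; rewrite mulrA => <-; last by exists 1; rewrite mul1r.
have Jyr : J (y * r : R).
  by apply: Jr; apply: submoduleB => //; exact: submoduleZ.
by rewrite /y mulrBr mulrA eJ // subrr.
Qed.

End SemisimpleRing.

(** * Multiplication in tensor products of algebras *)

Section TensorAlgebra.
Variables (k : fieldType) (A B : algType k).

Lemma tens_scalerAl (a : k) (x y : A ⊗ B) : a *: (x * y) = (a *: x) * y.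
Proof.
elim/tens_ind: x => [|x x' Hx Hx'|v w]; first by rewrite scaler0 !mul0r scaler0.
  by rewrite mulrDl !scalerDr mulrDl Hx Hx'.
elim/tens_ind: y => [|y y' Hy Hy'|v' w']; first by rewrite !mulr0 scaler0.
  by rewrite !mulrDr scalerDr Hy Hy'.
by rewrite -pureZl !tens_mulE -scalerAl pureZl.
Qed.

Lemma tens_scalerAr (a : k) (x y : A ⊗ B) : a *: (x * y) = x * (a *: y).
Proof.
elim/tens_ind: x => [|x x' Hx Hx'|v w]; first by rewrite !mul0r scaler0.
  by rewrite mulrDl scalerDr mulrDl Hx Hx'.
elim/tens_ind: y => [|y y' Hy Hy'|v' w'].
  by rewrite scaler0 !mulr0 scaler0.
  by rewrite mulrDr !scalerDr mulrDr Hy Hy'.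
by rewrite -pureZl !tens_mulE -scalerAr pureZl.
Qed.

Lemma slice_mulr (mu : {scalar A}) (t : A ⊗ B) (a : B) :
  slice mu (t * (1 ⊗ a)) = slice mu t * a.
Proof.
rewrite [t]tens_sumE mulr_suml.
under eq_bigr do rewrite tens_mulE mulr1.
rewrite -(big_map (fun p : A * B => (p.1, p.2 * a)) xpredT
  (fun p => p.1 ⊗ p.2)).
rewrite !slice_sum big_map mulr_suml; apply: eq_bigr => p _ /=.
by rewrite scalerAl.
Qed.

Lemma slice_mull (mu : {scalar A}) (t : A ⊗ B) (a : B) :
  slice mu ((1 ⊗ a) * t) = a * slice mu t.
Proof.
rewrite [t]tens_sumE mulr_sumr.
under eq_bigr do rewrite tens_mulE mul1r.
rewrite -(big_map (fun p : A * B => (p.1, a * p.2)) xpredT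
  (fun p => p.1 ⊗ p.2)).
rewrite !slice_sum big_map mulr_sumr; apply: eq_bigr => p _ /=.
by rewrite scalerAr.
Qed.

Lemma slice_mull1 (mu nu : {scalar A}) (t : A ⊗ B) (a : A) :
  (forall x, nu x = mu (a * x)) -> slice mu ((a ⊗ 1) * t) = slice nu t.
Proof.
move=> nuE; rewrite [t]tens_sumE mulr_sumr.
under eq_bigr do rewrite tens_mulE mul1r.
rewrite -(big_map (fun p : A * B => (a * p.1, p.2)) xpredT
  (fun p => p.1 ⊗ p.2)).
by rewrite !slice_sum big_map; apply: eq_bigr => p _ /=; rewrite nuE.
Qed.

End TensorAlgebra.

(** * The projection of a semisimple left coideal subalgebra *)

Section HopfAlgebra.
Variables (k : fieldType) (A : hopfAlgType k).

Lemma antipode_bilinear : bilinear_map (fun a b : A => antipode a * b).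
Proof.
split=> [b c a a'|a c b b'] /=.
  by rewrite linearP mulrDl scalerAl.
by rewrite mulrDr scalerAr.
Qed.

Definition sdelta (a b : A) : A ⊗ A := (antipode a ⊗ 1) * Delta b.

Lemma sdelta_bilinear : bilinear_map sdelta.
Proof.
split=> [b c a a'|a c b b'] /=; rewrite /sdelta.
  by rewrite linearP pureDl pureZl mulrDl tens_scalerAl.
by rewrite linearP mulrDr tens_scalerAr.
Qed.

(** By coassociativity, [S(x_1) x_2 ⊗ x_3 = eps(x_1) 1 ⊗ x_2 = 1 ⊗ x]. *)
Lemma sdelta_Delta x : tlift sdelta (Delta x) = 1 ⊗ x.
Proof.
(* [g] is defined on [A ⊗ (A ⊗ A)], where coassociativity can be used. *)
pose g (a : A) (t : A ⊗ A) : A ⊗ A := (antipode a ⊗ 1) * t.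
have g_bilin : bilinear_map g.
  split=> [t c a a'|a c t t'] /=; rewrite /g.
    by rewrite linearP pureDl pureZl mulrDl tens_scalerAl.
  by rewrite mulrDr tens_scalerAr.
have DD_bilin : bilinear_map (fun a b : A => (a : A) ⊗ Delta b).
  split=> [b c a a'|a c b b'] /=; first by rewrite pureDl pureZl.
  by rewrite linearP pureDr pureZr.
have D_bilin : bilinear_map (fun a b : A => Delta a ⊗ (b : A)).
  split=> [b c a a'|a c b b'] /=; first by rewrite linearP pureDl pureZl.
  by rewrite pureDr pureZr.
have in_bilin c : bilinear_map (fun a b : A => a ⊗ (b ⊗ (c : A))).
  split=> [b d a a'|a d b b'] /=; first by rewrite pureDl pureZl.
  by rewrite pureDl pureZl pureDr pureZr.
have as_bilin : bilinear_map
    (fun (t : A ⊗ A) c => tlift (fun a b => a ⊗ (b ⊗ (c : A))) t).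
  split=> [c d t t'|t d c c'] /=; first exact: tlift_linear.
  rewrite /tlift scaler_sumr -big_split; apply: eq_bigr => p _ /=.
  by rewrite !pureDr !pureZr.
have gl := tlift_linear g_bilin; have al := tlift_linear as_bilin.
have lhs t : tlift g (tmap idfun Delta t) = tlift sdelta t.
  move: t; apply: linear_tens_eq; last 1 first.
  - by move=> v w; rewrite /tmap !tlift_pure //; exact: sdelta_bilinear.
  - by move=> a t t'; rewrite /tmap (tlift_linear DD_bilin) gl.
  - exact: (tlift_linear sdelta_bilinear).
have assocS (t : A ⊗ A) c :
    tlift g (tassoc (t ⊗ c)) = tlift (fun a b => antipode a * b) t ⊗ c.
  rewrite /tassoc tlift_pure //; move: t; apply: linear_tens_eq; last 1 first.
  - move=> v w; rewrite !tlift_pure ?/g ?tens_mulE ?mul1r //.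
    exact: antipode_bilinear.
  - by move=> a t t'; rewrite (tlift_linear (in_bilin c)) gl.
  - by move=> a t t'; rewrite (tlift_linear antipode_bilinear) pureDl pureZl.
rewrite -lhs -DeltaA.
have -> : tlift g (tassoc (tmap Delta idfun (Delta x))) =
    1 ⊗ slice eps (Delta x).
  move: (Delta x); apply: linear_tens_eq.
  - by move=> a t t'; rewrite /tmap (tlift_linear D_bilin) /tassoc al gl.
  - by move=> a t t'; rewrite slice_linear pureDr pureZr.
  move=> v w; rewrite /tmap tlift_pure // assocS antipodel slice_pure.
  by rewrite pureZl pureZr.
by rewrite eps_Deltal.
Qed.

(** Apply [a ⊗ b |-> S(a) b_1 ⊗ b_2] to both sides of the hypothesis: the right
    side becomes [S(x) P_1 ⊗ P_2] and the left side
    [S(x_1) x_2 P_1 ⊗ x_3 P_2 = P_1 ⊗ x P_2]. *)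
Lemma antipode_swap (P x : A) : Delta x * (1 ⊗ P) = x ⊗ P ->
  (1 ⊗ x) * Delta P = (antipode x ⊗ 1) * Delta P.
Proof.
move=> xP; rewrite -sdelta_Delta -[RHS](tlift_pure sdelta_bilinear) -xP.
move: (Delta x); apply: linear_tens_eq => [a t t'|a t t'|v w].
- by rewrite (tlift_linear sdelta_bilinear) mulrDl tens_scalerAl.
- by rewrite mulrDl -tens_scalerAl (tlift_linear sdelta_bilinear).
by rewrite tens_mulE !(tlift_pure sdelta_bilinear) mulr1 /sdelta rmorphM mulrA.
Qed.

(** [x mu(P_1) P_2 = mu(S(x) P_1) P_2]. *)
Lemma VP_left_ideal (P x y : A) :
  Delta x * (1 ⊗ P) = x ⊗ P -> VP P y -> VP P (x * y).
Proof.
move=> xP [mu _ <-]; rewrite -slice_mull antipode_swap //.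
pose f (z : A) : k := mu (antipode x * z).
have f_lin : scalar f by move=> a u v; rewrite /f mulrDr -scalerAr linearP.
have [nu nuE] := scalar_functional f_lin.
by exists nu => //; rewrite (slice_mull1 _ nuE).
Qed.

Lemma VP_submodule (P : A) : submodule (VP P : set A).
Proof.
split=> [|a _ _ [mu _ <-] [nu _ <-]].
  have [|mu mu0] := @scalar_functional k A (fun=> 0).
    by move=> a x y; rewrite mulr0 addr0.
  exists mu => //; rewrite [Delta P]tens_sumE slice_sum big1 // => p _.
  by rewrite mu0 scale0r.
have [|la laE] := @scalar_functional k A (fun x => a * mu x + nu x).
  by move=> c x y; rewrite !linearP /= !mulrDr addrACA !mulrA (mulrC a).
exists la => //; rewrite [Delta P]tens_sumE !slice_sum scaler_sumr -big_split.
by apply: eq_bigr => p _; rewrite laE scalerDl scalerA.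
Qed.

(** [Delta P (1 ⊗ e) = Delta P] because slices separate tensors; hence
    [e = S(P_1) P_2 e = S(P_1) P_2 = 1]. *)
Lemma VP_right_identity (P e : A) : eps P = 1 ->
  (forall x, VP P x -> x * e = x) -> e = 1.
Proof.
move=> epsP eVP.
have De : Delta P * (1 ⊗ e) = Delta P.
  apply/eqP; rewrite -subr_eq0; apply/eqP/slices_separate => mu.
  rewrite -scaleN1r addrC slice_linear slice_mulr eVP; last by exists mu.
  by rewrite scaleN1r addNr.
have Se t : tlift (fun a b => antipode a * b) (t * (1 ⊗ e)) =
    tlift (fun a b => antipode a * b) t * e.
  move: t; apply: linear_tens_eq => [a t t'|a t t'|v w].
  - by rewrite mulrDl -tens_scalerAl (tlift_linear antipode_bilinear).
  - by rewrite (tlift_linear antipode_bilinear) mulrDl scalerAl.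
  by rewrite tens_mulE !(tlift_pure antipode_bilinear) mulr1 mulrA.
by have := Se (Delta P); rewrite De antipodel epsP scale1r mul1r.
Qed.

Lemma eps_alg c : eps (c%:A : A) = c.
Proof.
have := linearP (@eps k A) c 1 0.
by rewrite addr0 rmorph1 rmorph0 addr0 mulr1.
Qed.

Section Coideal.
Variable N : subalgClosed A.

Lemma subalg_closedB (x y : A) : x \in N -> y \in N -> x - y \in N.
Proof. by move=> xN yN; rewrite -scaleN1r rpredD ?rpredZ. Qed.

(** The complement [1 - e] of the identity [e] of the augmentation ideal. *)
Lemma integral_exists : semisimple_ring (subalg_type N) ->
  exists P : A, [/\ P \in N, eps P = 1 &
    forall x, x \in N -> x * P = eps x *: P /\ P * x = eps x *: P].
Proof.
move=> ssN; pose J : set (subalg_type N)^o := [set x | eps (val x) = 0 :> k].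
have [||e Je eJ] := @semisimple_ideal_identity _ J ssN.
- split=> [|a x y]; rewrite /J /=; first exact: raddf0.
  move=> x0 y0; suff: eps (val a * val x + val y) = 0 :> k by [].
  by rewrite rmorphD rmorphM /= x0 y0 mulr0 addr0.
- move=> x r; rewrite /J /= => x0.
  suff: eps (val x * val r) = 0 :> k by [].
  by rewrite rmorphM /= x0 mul0r.
have augJ x : x \in N ->
    exists2 y : subalg_type N, J y & x = val y + (eps x)%:A.
  move=> xN; have yN : x - (eps x)%:A \in N.
    by rewrite subalg_closedB ?rpredZ ?rpred1.
  exists (exist (fun z : A => z \in N) _ yN); rewrite /J /= ?subrK //.
  by rewrite raddfB /= eps_alg subrr.
pose P := 1 - val e; exists P; split=> [||x xN].
- by rewrite subalg_closedB ?rpred1 ?(valP e).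
- by rewrite rmorphB rmorph1 /= Je subr0.
have [y Jy ->] := augJ x xN; have [ye ey] := eJ y Jy.
have epsE : eps (val y + (eps x)%:A) = eps x.
  by rewrite raddfD /= eps_alg Jy add0r.
have yP : val y * P = 0.
  by rewrite mulrBr mulr1 (congr1 val ye : val y * val e = val y) subrr.
have Py : P * val y = 0.
  by rewrite mulrBl mul1r (congr1 val ey : val e * val y = val y) subrr.
rewrite epsE; split.
  by rewrite mulrDl yP add0r -scalerAl mul1r.
by rewrite [LHS]mulrDr Py add0r -scalerAr mulr1.
Qed.

Lemma VP_coideal (P : A) :
  left_coideal N -> P \in N -> VP P `<=` [set` N].
Proof.
move=> N_coideal PN _ [mu _ <-] /=; have [s -> sN] := N_coideal _ PN.
rewrite slice_sum big_seq; apply: rpred_sum => p ps.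
by rewrite rpredZ ?sN.
Qed.

(** [x_1 ⊗ x_2 P = x_1 ⊗ eps(x_2) P = x ⊗ P], as [x_2] ranges over [N]. *)
Lemma coideal_sub_NP (P : A) : left_coideal N ->
  (forall x, x \in N -> x * P = eps x *: P /\ P * x = eps x *: P) ->
  [set` N] `<=` NP P.
Proof.
move=> N_coideal PN x /= xN.
suff [DP PD] : Delta x * (1 ⊗ P) = x ⊗ P /\ (1 ⊗ P) * Delta x = x ⊗ P.
  by split; rewrite ?DP ?PD.
have [s Ds sN] := N_coideal _ xN.
have xE : x ⊗ P = \sum_(p <- s) p.1 ⊗ (eps p.2 *: P).
  rewrite -{1}[x]eps_Deltar Ds /slicer tlift_sum ?pure_suml.
    by apply: eq_bigr => p _; rewrite pureZl pureZr.
  split=> [b c a a'|a c b b'] /=; first by rewrite scalerDr !scalerA mulrC.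
  by rewrite linearP scalerDl scalerA.
rewrite xE Ds mulr_suml mulr_sumr; split; apply: eq_big_seq => p ps;
  by have [xP Px] := PN _ (sN p ps); rewrite tens_mulE ?xP ?Px ?mulr1 ?mul1r.
Qed.

End Coideal.
End HopfAlgebra.

Theorem proposition3p23 (k : fieldType) (A : hopfAlgType k)
    (S_invertible : bijective (@antipode k A))
    (N : subalgClosed A) (N_coideal : left_coideal N)
    (N_semisimple : semisimple_ring (subalg_type N)) :
  exists P : A,
    [/\ right_grouplike_projection P, [set` N] = NP P & NP P = VP P].
Proof.
have [P [PN epsP Pint]] := integral_exists N_semisimple.
have N_NP := coideal_sub_NP N_coideal Pint.
have VP_N := VP_coideal N_coideal PN.
have VP1 : VP P 1.
  pose U : set (subalg_type N)^o := [set x | VP P (val x)].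
  have sVP := VP_submodule P.
  have sU : submodule U.
    split=> [|a x y Ux Uy]; first by case: sVP.
    suff: VP P (val a * val x + val y) by [].
    apply: submoduleD => //; apply: VP_left_ideal => //.
    by have [-> ->] := N_NP _ (valP a).
  have [e Ue eU] := semisimple_right_identity N_semisimple sU.
  suff <- : val e = 1 by [].
  apply: (VP_right_identity epsP) => x Vx.
  have xN : x \in N := VP_N _ Vx.
  exact: (congr1 (fun z : subalg_type N => val z)
    (eU (exist (fun z : A => z \in N) x xN) Vx)).
have NP_VP : NP P `<=` VP P.
  by move=> x [xP Px]; rewrite -[x]mulr1; apply: VP_left_ideal; rewrite ?xP.
exists P; split.
- have [DP PD] := N_NP P PN; split=> //.
  + apply/eqP => P0; move: epsP; rewrite P0 raddf0 => /eqP.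
    by rewrite eq_sym oner_eq0.
  + by have [-> _] := Pint P PN; rewrite epsP scale1r.
  + by rewrite DP.
- by apply/seteqP; split=> // x /NP_VP/VP_N.
- by apply/seteqP; split=> // x /VP_N/N_NP.
Qed.
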